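(* Let $\alpha>0$, $\beta>0$, $\gamma\ge0$, $0\le\phi\le1$ and let $X\sim\text{LPushBeta}(\alpha,\beta,\gamma,\phi)$. Then for all $k=1,2,3,\ldots$, $$\mathbb{E}(X^k)=\frac{\mathrm{B}(\alpha+k,\beta)}{\mathrm{B}(\alpha,\beta)}\cdot\frac{{}_2F_1(-\gamma,\alpha+k,\alpha+\beta+k;\phi)}{{}_2F_1(-\gamma,\alpha,\alpha+\beta;\phi)},$$ and this can be written in the alternative form $$\mathbb{E}(X^k)=\frac{\int_0^1 x^{\alpha+k-1}(1-x)^{\beta-1}(1-x\phi)^{\gamma}\,dx}{\int_0^1 x^{\alpha-1}(1-x)^{\beta-1}(1-x\phi)^{\gamma}\,dx}.$$
   Context: $\mathrm{B}$ is the beta function and ${}_2F_1(a,b,c;z)$ is the Gaussian hypergeometric function with numerator parameters $a,b$ and denominator parameter $c$. For $\alpha>0$, $\beta>0$, $\gamma\ge 0$, $0\le\phi\le 1$, the left-pushed beta distribution $\text{LPushBeta}(\alpha,\beta,\gamma,\phi)$ is the continuous distribution on the unit interval with density $$\text{LPushBeta}(x|\alpha,\beta,\gamma,\phi)=\frac{x^{\alpha-1}(1-x)^{\beta-1}(1-x\phi)^{\gamma}}{\int_0^1 t^{\alpha-1}(1-t)^{\beta-1}(1-t\phi)^{\gamma}\,dt}=\frac{x^{\alpha-1}(1-x)^{\beta-1}(1-x\phi)^{\gamma}}{\mathrm{B}(\alpha,\beta)\,{}_2F_1(-\gamma,\alpha,\alpha+\beta;\phi)},\qquad 0\le x\le 1$$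 (the two expressions agree by Euler's integral formula). *)

(* Defs.v *)
From HB Require Import structures.
From mathcomp Require Import all_boot all_order all_algebra.
From mathcomp Require Import all_classical all_reals all_analysis.

Set Implicit Arguments.
Unset Strict Implicit.
Unset Printing Implicit Defensive.

Import Order.TTheory GRing.Theory Num.Theory.
Import numFieldNormedType.Exports.

Local Open Scope classical_set_scope.
Local Open Scope ring_scope.

(* Euler's beta function at real arguments; the library's [beta_fun] only takes
   natural numbers. Since [0 `^ r = 0] for [r != 0], the integrands below are
   real-valued at 0 and 1 even for negative exponents; this affects a null set
   only. *)
Definition Beta (R : realType) (a b : R) : R :=
  \int[lebesgue_measure]_(t in `[0, 1]) (t `^ (a - 1) * (1 - t) `^ (b - 1)).

Definition pochhammer (R : realType) (a : R) (n : nat) : R :=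
  \prod_(i < n) (a + i%:R).

(* Sum of the Gauss series. For real arguments with [c] not a nonpositive
   integer, it converges when [`|z| < 1], and also at [z = 1] when
   [0 < c - a - b]. *)
Definition hyp2F1 (R : realType) (a b c z : R) : R :=
  limn (series (fun n : nat =>
    pochhammer a n * pochhammer b n / pochhammer c n * (z ^+ n / n`!%:R))).

Definition lpushbeta_kernel (R : realType) (alpha beta gamma phi x : R) : R :=
  x `^ (alpha - 1) * (1 - x) `^ (beta - 1) * (1 - x * phi) `^ gamma.

Definition lpushbeta_pdf (R : realType) (alpha beta gamma phi : R) : R -> R :=
  (fun x => lpushbeta_kernel alpha beta gamma phi x /
     \int[lebesgue_measure]_(t in `[0, 1])
       lpushbeta_kernel alpha beta gamma phi t) \_ `[0, 1].

Definition LPushBeta_distributed (R : realType) (d : measure_display)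
    (T : measurableType d) (P : probability T R) (X : {RV P >-> R})
    (alpha beta gamma phi : R) : Prop :=
  forall A : set R, measurable A ->
    distribution P X A =
    (\int[lebesgue_measure]_(x in A)
       (lpushbeta_pdf alpha beta gamma phi x)%:E)%E.

(* Main.v *)
Require Import Defs.
From HB Require Import structures.
From mathcomp Require Import all_boot all_order all_algebra.
From mathcomp Require Import all_classical all_reals all_analysis.
From mathcomp Require Import measurable_realfun ring lra.

Set Implicit Arguments.
Unset Strict Implicit.
Unset Printing Implicit Defensive.

Import Order.TTheory GRing.Theory Num.Theory.
Import numFieldNormedType.Exports.

Local Open Scope classical_set_scope.
Local Open Scope ring_scope.

(** Both formulas reduce to Euler's identity
    [\int_0^1 t^(a-1) (1-t)^(b-1) (1-tz)^g dt = B(a,b) 2F1(-g,a;a+b;z)], since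
    integrating [x^k] against the density shifts [alpha] to [alpha + k].

    For Euler's identity, expand [(1-tz)^g] into its binomial series and integrate
    term by term, using [B(a+n,b) = (a)_n / (a+b)_n B(a,b)]. As [g >= 0], the
    binomial coefficients are absolutely summable, so the partial sums are
    uniformly bounded on [[0, 1]] and dominated convergence applies; this includes
    [z = 1], because pointwise convergence is only needed for [t < 1]. The binomial
    series itself converges because [S_N(y) (1-y)^(-g)], with [S_N] the partial sum,
    has a derivative consisting of a single term of order [y^(N-1)]. *)

(** * Improper integrals by the fundamental theorem of calculus *)

(** Exhausts the open interval by compact ones, applies the usual theorem there and passes to the
    limit by monotone convergence. Nonnegativity thus replaces integrability, and [f] may blow up at
    both ends. *)
Lemma ge0_FTC2_itvoo (R : realType) (f F : R -> R) (a b : R) :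
  a < b ->
  {in `]a, b[, forall x, 0 <= f x} ->
  {in `]a, b[, continuous f} ->
  (forall x : R, x \in `]a, b[ -> is_derive x (1 : R) F (f x)) ->
  F x @[x --> a^'+] --> F a -> F x @[x --> b^'-] --> F b ->
  (\int[lebesgue_measure]_(x in `[a, b]) (f x)%:E = (F b - F a)%:E)%E.
Proof.
move=> ab f0 cf dF Fa Fb.
(* Starting at a third of the length keeps every [[a + e n, b - e n]] nondegenerate. *)
pose e (n : nat) : R := (b - a) / n.+3%:R.
have ba0 : 0 < b - a by rewrite subr_gt0.
have e0 n : 0 < e n by rewrite divr_gt0.
have e3 n : e n <= (b - a) / 3.
  by rewrite ler_pM2l// lef_pV2 ?posrE// ler_nat.
have e_noninc m n : (m <= n)%N -> e n <= e m.
  by move=> mn; rewrite ler_pM2l// lef_pV2 ?posrE// ler_nat !ltnS.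
have cvge : e @ \oo --> (0 : R).
  rewrite -[X in _ --> X](mulr0 (b - a)); apply: cvgMr.
  have := @cvg_harmonic R; rewrite -(cvg_shiftn 2) => /=.
  by under eq_fun do rewrite /harmonic addn2.
pose I n := `[a + e n, b - e n]%classic.
have lt_ab n : a + e n < b - e n by have := e3 n; lra.
have subI n x : I n x -> x \in `]a, b[.
  rewrite /I/= !in_itv/= => /andP[? ?]; have := e0 n.
  by move=> ?; apply/andP; split; lra.
have cF x : x \in `]a, b[ -> {for x, continuous F}.
  by move=> /dF [dFx _]; exact/differentiable_continuous/derivable1_diffP.
have UI : \bigcup_n I n = `]a, b[%classic.
  apply/seteqP; split => [x [n _ /subI]//|x/=]; rewrite in_itv/= => /andP[ax xb].
  have : \forall n \near \oo, e n < Num.min (x - a) (b - x).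
    have m0 : 0 < Num.min (x - a) (b - x) by rewrite lt_min !subr_gt0 ax.
    by apply: cvgr_lt cvge _ m0.
  move=> [n _ /(_ n (leqnn n))/=]; rewrite lt_min => /andP[h1 h2].
  by exists n => //; rewrite /I/= in_itv/=; apply/andP; split; lra.
have mf n : measurable_fun (I n) f.
  apply: (@measurable_funS _ _ _ _ `]a, b[%classic) => //.
    by move=> x /subI.
  apply: open_continuous_measurable_fun => //.
  by move=> x; rewrite inE => /cf.
rewrite integral_itv_bndoo; last first.
  apply/measurable_EFinP; apply: open_continuous_measurable_fun => //.
  by move=> x; rewrite inE => /cf.
have := @ge0_nondecreasing_set_cvg_integral _ (measurableTypeR R) R I (EFin \o f)
  lebesgue_measure.
rewrite UI => H.
apply: (cvg_unique _ (H _ _ _ _)) => //=.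
- apply/nondecreasing_seqP => n; rewrite subsetEset => x.
  rewrite /I/= !in_itv/= => /andP[? ?]; have := e_noninc n n.+1 (leqnSn n).
  by move=> ?; apply/andP; split; lra.
- by move=> i; exact: measurable_itv.
- by move=> n; apply/measurable_EFinP; exact: mf.
- by move=> i x /subI /f0; rewrite lee_fin.
- rewrite (_ : (fun n => _) = EFin \o (fun n => F (b - e n) - F (a + e n))).
    apply: cvg_EFin; first exact: nearW.
    apply: cvgB.
      move/cvg_at_leftP : Fb; apply; split.
        by move=> n; rewrite gtrBl.
      by rewrite -[X in _ --> X]subr0; apply: cvgB => //; exact: cvg_cst.
    move/cvg_at_rightP : Fa; apply; split.
      by move=> n; rewrite ltrDl.
    by rewrite -[X in _ --> X]addr0; apply: cvgD => //; exact: cvg_cst.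
  apply/funext => n /=; rewrite EFinB; apply: continuous_FTC2 => //.
  + apply: continuous_in_subspaceT => x; rewrite inE => /subI; exact: cf.
  + have cFn : {within I n, continuous F}.
      by apply: continuous_in_subspaceT => x; rewrite inE => /subI; exact: cF.
    have [_ Fan Fbn] := (continuous_within_itvP _ (lt_ab n)).1 cFn.
    split => // x xI; have : I n x by exact: subset_itv_oo_cc xI.
    by move=> /subI/dF [].
  + move=> x xI; have : I n x by exact: subset_itv_oo_cc xI.
    by move=> /subI/dF [_ <-]; rewrite derive1E.
Qed.

(** * Real powers of [x] and [1 - x] *)

Section powR_onem.
Context {R : realType}.
Implicit Types a b x : R.

Lemma powR_le1 x p : 0 <= x -> x <= 1 -> 0 <= p -> x `^ p <= 1.
Proof.
move=> x0 x1 p0; have := @ge0_ler_powR R p p0 x 1.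
by rewrite powR1; apply; rewrite ?nnegrE.
Qed.

Lemma continuous_powR a x : 0 < x -> {for x, continuous (@powR R ^~ a)}.
Proof.
move=> x0; apply/differentiable_continuous/derivable1_diffP.
by apply: derivable_powR; rewrite in_itv/= x0.
Qed.

Lemma is_derive_onem_powR b x : x < 1 ->
  is_derive x (1 : R) (fun t => (1 - t) `^ b) (- (b * (1 - x) `^ (b - 1))).
Proof.
move=> x1; have x0 : 0 < 1 - x by rewrite subr_gt0.
have d1 : is_derive x (1 : R) (fun t : R => 1 - t) (-1).
  by apply: is_derive_eq; rewrite add0r mul1r.
have := @is_derive1_comp R (@powR R ^~ b) (fun t => 1 - t) x _ _
  (is_derive1_powR b x0) d1.
by rewrite mulrN1.
Qed.

Lemma continuous_onem_powR b x : x < 1 ->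
  {for x, continuous (fun t : R => (1 - t) `^ b)}.
Proof.
move=> x1; apply/differentiable_continuous/derivable1_diffP.
by have [] := is_derive_onem_powR b x1.
Qed.

Lemma cvg_onem_powR b : 0 < b -> (1 - t : R) `^ b @[t --> (1 : R)^'-] --> (0 : R).
Proof.
move=> b0; apply/cvg_at_leftP => u [u1 cu].
have /cvg_at_rightP := powR_cvg0 b0; apply; split.
  by move=> n; rewrite subr_gt0.
by rewrite -[X in _ --> X](subrr (1 : R)); apply: cvgB => //; exact: cvg_cst.
Qed.

End powR_onem.

(** * Integrability of the beta kernel and recurrences for [Beta] *)

Definition beta_kernel (R : realType) (a b t : R) : R :=
  t `^ (a - 1) * (1 - t) `^ (b - 1).

Section beta_kernel.
Context {R : realType}.
Implicit Types a b x t : R.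
Notation mu := (@lebesgue_measure R).

Lemma beta_kernel_ge0 a b t : 0 <= beta_kernel a b t.
Proof. by rewrite mulr_ge0 ?powR_ge0. Qed.

Lemma measurable_onem_powR b : measurable_fun [set: R] (fun t : R => (1 - t) `^ b).
Proof.
apply: (measurableT_comp (@measurable_powR R b)).
by apply: measurable_funB => //; exact: measurable_cst.
Qed.

Lemma measurable_beta_kernel a b : measurable_fun [set: R] (beta_kernel a b).
Proof.
apply: measurable_funM; first exact: measurable_powR.
exact: measurable_onem_powR.
Qed.

Lemma beta_kernel_succl a b t : 0 < a -> 0 <= t <= 1 ->
  beta_kernel (a + 1) b t = t * beta_kernel a b t.
Proof.
by move=> a0 /andP[t0 t1]; rewrite /beta_kernel mulrA mulr_powRB1// addrK.
Qed.

Lemma beta_kernel_succr a b t : 0 < b -> 0 <= t <= 1 ->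
  beta_kernel a (b + 1) t = (1 - t) * beta_kernel a b t.
Proof.
move=> b0 /andP[t0 t1].
by rewrite /beta_kernel mulrCA mulr_powRB1 ?subr_ge0// addrK.
Qed.

Lemma integral_beta_kernelx1 a : 0 < a ->
  (\int[mu]_(t in `[0%R, 1%R]) (a * beta_kernel a 1 t)%:E = 1)%E.
Proof.
move=> a0.
transitivity (1 `^ a - 0 `^ a)%:E; last by rewrite powR1 powR0 ?gt_eqF// subr0.
apply: (@ge0_FTC2_itvoo R _ (@powR R ^~ a)) => //.
- by move=> x _; rewrite mulr_ge0 ?beta_kernel_ge0// ltW.
- move=> x; rewrite in_itv/= => /andP[x0 x1].
  rewrite /beta_kernel subrr; under eq_fun do rewrite powRr0 mulr1.
  by apply: cvgMr; exact: continuous_powR.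
- move=> x; rewrite in_itv/= => /andP[x0 x1].
  by rewrite /beta_kernel subrr powRr0 mulr1; exact: is_derive1_powR.
- by rewrite powR0 ?gt_eqF//; exact: powR_cvg0.
- by apply: cvg_at_left_filter; exact: continuous_powR.
Qed.

Lemma integral_beta_kernel1x b : 0 < b ->
  (\int[mu]_(t in `[0%R, 1%R]) (b * beta_kernel 1 b t)%:E = 1)%E.
Proof.
move=> b0.
transitivity (- (1 - 1) `^ b - - (1 - 0) `^ b)%:E; last first.
  by rewrite subrr subr0 powR1 powR0 ?gt_eqF// oppr0 sub0r opprK.
apply: (@ge0_FTC2_itvoo R _ (fun t => - (1 - t) `^ b)) => //.
- by move=> x _; rewrite mulr_ge0 ?beta_kernel_ge0// ltW.
- move=> x; rewrite in_itv/= => /andP[x0 x1].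
  rewrite /beta_kernel subrr; under eq_fun do rewrite powRr0 mul1r.
  by apply: cvgMr; exact: continuous_onem_powR.
- move=> x; rewrite in_itv/= => /andP[x0 x1].
  rewrite /beta_kernel subrr powRr0 mul1r -[X in is_derive _ _ _ X]opprK.
  by apply: is_deriveN; exact: is_derive_onem_powR.
- apply: cvg_at_right_filter; apply: cvgN.
  exact: (@continuous_onem_powR R b 0 ltr01).
- by apply: cvgN; rewrite subrr powR0 ?gt_eqF//; exact: cvg_onem_powR.
Qed.

Lemma integrable_beta_kernel a b : 0 < a -> 0 < b ->
  mu.-integrable `[0, 1] (EFin \o beta_kernel a b).
Proof.
have aux (f : R -> R) c : 0 < c -> measurable_fun [set: R] f ->
    (forall t, 0 <= f t) ->
    (\int[mu]_(t in `[0%R, 1%R]) (c * f t)%:E = 1)%E ->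
    mu.-integrable `[0, 1] (EFin \o f).
  move=> c0 mf f0 ifc.
  have icf : mu.-integrable `[0, 1] (fun t => (c * f t)%:E).
    apply/integrableP; split.
      apply/measurable_EFinP; apply: measurable_funM => //.
      exact: measurable_funTS.
    under eq_integral do rewrite gee0_abs ?lee_fin ?mulr_ge0 ?(ltW c0)//.
    by rewrite ifc ltry.
  rewrite (_ : EFin \o f = (fun t => c^-1%:E * (c * f t)%:E)%E).
    exact: integrableZl.
  by apply/funext => t /=; rewrite -EFinM mulKf// gt_eqF.
move=> a0 b0.
have ia := aux _ _ a0 (@measurable_beta_kernel a 1) (beta_kernel_ge0 a 1)
  (integral_beta_kernelx1 a0).
have ib := aux _ _ b0 (@measurable_beta_kernel 1 b) (beta_kernel_ge0 1 b)
  (integral_beta_kernel1x b0).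
apply: (le_integrable _ _ _ (integrableD _ ia ib)) => //.
  by apply/measurable_EFinP/measurable_funTS; exact: measurable_beta_kernel.
move=> t /=; rewrite in_itv/= => /andP[t0 t1].
rewrite lee_fin !ger0_norm ?addr_ge0 ?beta_kernel_ge0//.
(* Splitting [1 = t + (1 - t)] raises one exponent in each summand; the raised power is at most 1,
   which leaves only one endpoint singularity per summand. *)
rewrite -[beta_kernel a b t]mul1r -[X in X * _](subrK t) mulrDl addrC.
rewrite -beta_kernel_succr -?beta_kernel_succl ?t0//.
rewrite /beta_kernel subrr !addrK !powRr0 mulr1 mul1r.
rewrite addrC lerD//.
  by rewrite -[leRHS]mulr1 ler_wpM2l ?powR_ge0// powR_le1 ?(ltW b0)//; lra.
by rewrite -[leRHS]mul1r ler_wpM2r ?powR_ge0// powR_le1 ?(ltW a0)//; lra.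
Qed.

Lemma BetaE a b : Beta a b = \int[mu]_(t in `[0, 1]) beta_kernel a b t.
Proof. by []. Qed.

(** Integrates [t + (1 - t) = 1] against the kernel. *)
Lemma Beta_succD a b : 0 < a -> 0 < b ->
  Beta (a + 1) b + Beta a (b + 1) = Beta a b.
Proof.
move=> a0 b0; rewrite !BetaE -RintegralD//; last 2 first.
- by apply: integrable_beta_kernel => //; rewrite addr_gt0.
- by apply: integrable_beta_kernel => //; rewrite addr_gt0.
apply: eq_Rintegral => t; rewrite inE/= in_itv/= => t01.
by rewrite beta_kernel_succl// beta_kernel_succr// -mulrDl subrKC mul1r.
Qed.

(* The derivative of [t^a (1-t)^b] changes sign; adding the derivative of
   [t^a - (1-t)^b] makes it nonnegative. *)
Lemma Beta_succ_sym a b : 0 < a -> 0 < b ->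
  a * Beta a (b + 1) = b * Beta (a + 1) b.
Proof.
move=> a0 b0.
pose F (t : R) := t `^ a * (1 - t) `^ b + (t `^ a - (1 - t) `^ b).
pose f t := (a * beta_kernel a (b + 1) t - b * beta_kernel (a + 1) b t) +
  (a * beta_kernel a 1 t + b * beta_kernel 1 b t).
have F1 : F 1 - F 0 = 2.
  rewrite /F subrr !powR0 ?gt_eqF// !subr0 powR1; lra.
(* In this grouping every factor is visibly nonnegative on the unit interval. *)
have fE t : f t = a * t `^ (a - 1) * (1 + (1 - t) `^ b) +
    b * (1 - t) `^ (b - 1) * (1 - t `^ a).
  by rewrite /f /beta_kernel subrr !addrK !powRr0; ring.
have IF : (\int[mu]_(t in `[0%R, 1%R]) (f t)%:E = 2%:E)%E.
  rewrite -F1; apply: ge0_FTC2_itvoo => //.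
  - move=> t; rewrite in_itv/= => /andP[t0 t1].
    rewrite fE addr_ge0// !mulr_ge0 ?powR_ge0 ?(ltW a0) ?(ltW b0)//.
      by rewrite addr_ge0 ?powR_ge0.
    by rewrite subr_ge0 powR_le1 ?(ltW a0)// !ltW.
  - move=> t; rewrite in_itv/= => /andP[t0 t1].
    rewrite /prop_for /continuous_at fE.
    rewrite (_ : f = fun u => a * u `^ (a - 1) * (1 + (1 - u) `^ b) +
      b * (1 - u) `^ (b - 1) * (1 - u `^ a)); last exact/funext.
    apply: cvgD; apply: cvgM.
    + by apply: cvgMr; exact: continuous_powR.
    + by apply: cvgD; [exact: cvg_cst|exact: continuous_onem_powR].
    + by apply: cvgMr; exact: continuous_onem_powR.
    + by apply: cvgB; [exact: cvg_cst|exact: continuous_powR].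
  - move=> t; rewrite in_itv/= => /andP[t0 t1].
    have d1 := is_derive1_powR a t0; have d2 := is_derive_onem_powR b t1.
    apply: is_derive_eq; rewrite fE /GRing.scale/=; ring.
  - apply: cvgD; [apply: cvgM|apply: cvgB].
    + by rewrite powR0 ?gt_eqF//; exact: powR_cvg0.
    + by apply: cvg_at_right_filter; exact: (@continuous_onem_powR R b 0 ltr01).
    + by rewrite powR0 ?gt_eqF//; exact: powR_cvg0.
    + by apply: cvg_at_right_filter; exact: (@continuous_onem_powR R b 0 ltr01).
  - apply: cvgD; [apply: cvgM|apply: cvgB].
    + by apply: cvg_at_left_filter; exact: continuous_powR.
    + by rewrite subrr powR0 ?gt_eqF//; exact: cvg_onem_powR.
    + by apply: cvg_at_left_filter; exact: continuous_powR.
    + by rewrite subrr powR0 ?gt_eqF//; exact: cvg_onem_powR.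
have iZ c p q : 0 < p -> 0 < q ->
    mu.-integrable `[0, 1] (EFin \o (fun t => c * beta_kernel p q t)).
  move=> p0 q0; rewrite (_ : _ \o _ = (fun t => c%:E * (beta_kernel p q t)%:E)%E)//.
  by apply: integrableZl => //; exact: integrable_beta_kernel.
have IZ c p q : 0 < p -> 0 < q ->
    \int[mu]_(t in `[0, 1]) (c * beta_kernel p q t) = c * Beta p q.
  by move=> p0 q0; rewrite RintegralZl//; exact: integrable_beta_kernel.
have a1 : 0 < a + 1 by rewrite addr_gt0.
have b1 : 0 < b + 1 by rewrite addr_gt0.
have : \int[mu]_(t in `[0, 1]) f t = 2 by rewrite /Rintegral IF.
rewrite /f RintegralD//=; last 2 first.
- by apply: (integrableB _ (iZ a a (b + 1) _ _) (iZ b (a + 1) b _ _)).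
- by apply: (integrableD _ (iZ a a 1 _ _) (iZ b 1 b _ _)).
rewrite RintegralB//=; [|exact: iZ|exact: iZ].
rewrite RintegralD//=; [|exact: iZ|exact: iZ].
(* The two added terms integrate to 1 each and use up the total 2, so the original derivative
   integrates to 0. *)
rewrite IZ// IZ// /Rintegral integral_beta_kernelx1// integral_beta_kernel1x//=.
lra.
Qed.

(** Solves the two linear relations [Beta_succD] and [Beta_succ_sym] for [Beta (a + 1) b]. *)
Lemma Beta_succl a b : 0 < a -> 0 < b -> Beta (a + 1) b = a / (a + b) * Beta a b.
Proof.
move=> a0 b0; have ab : a + b != 0 by rewrite gt_eqF// addr_gt0.
have := Beta_succ_sym a0 b0; rewrite -(Beta_succD a0 b0) => h.
apply: (mulfI ab); rewrite mulrA mulrCA divff// mulr1 mulrDr h; ring.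
Qed.

(** Source of the quotients $(a)_n/(a+b)_n$ in the Gauss series. *)
Lemma Beta_addn a b n : 0 < a -> 0 < b ->
  Beta (a + n%:R) b = pochhammer a n / pochhammer (a + b) n * Beta a b.
Proof.
move=> a0 b0; elim: n => [|n IH].
  by rewrite /pochhammer !big_ord0 divr1 addr0 mul1r.
have an0 : 0 < a + n%:R by rewrite ltr_wpDr.
rewrite -natr1 addrA Beta_succl// IH /pochhammer !big_ord_recr/= invfM.
by rewrite (addrAC a); ring.
Qed.

End beta_kernel.

(* [binomial_coef g n] is the coefficient of [y ^+ n] in the expansion of
   [(1 - y) `^ g]. *)
Definition binomial_coef (R : realType) (g : R) (n : nat) : R :=
  pochhammer (- g) n / n`!%:R.

(** * Binomial coefficients and the binomial series *)

Section binomial_coef.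
Context {R : realType}.
Implicit Types (g y : R) (n N : nat).

Lemma pochhammerS g n : pochhammer g n.+1 = pochhammer g n * (g + n%:R).
Proof. exact: big_ord_recr. Qed.

Lemma pochhammerSl g n : pochhammer g n.+1 = g * pochhammer (g + 1) n.
Proof.
rewrite /pochhammer big_ord_recl/= addr0; congr (_ * _).
by apply: eq_bigr => i _; rewrite /bump/= add1n -natr1 addrA addrAC.
Qed.

Lemma factSr n : (n.+1)`!%:R = n.+1%:R * n`!%:R :> R.
Proof. by rewrite factS natrM. Qed.

Let factr_neq0 n : n`!%:R != 0 :> R.
Proof. by rewrite pnatr_eq0 -lt0n fact_gt0. Qed.

Lemma binomial_coef0 g : binomial_coef g 0 = 1.
Proof. by rewrite /binomial_coef /pochhammer big_ord0 fact0 divr1. Qed.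

Lemma binomial_coefS g n :
  n.+1%:R * binomial_coef g n.+1 = (n%:R - g) * binomial_coef g n.
Proof.
rewrite /binomial_coef pochhammerS factSr.
have : n.+1%:R != 0 :> R by rewrite pnatr_eq0.
by move: (factr_neq0 n) => *; field; apply/andP.
Qed.

(** Splits off the first Pochhammer factor instead of the last; by [sum_binomial_coef] the right
    side is then $-g$ times a partial sum of coefficients. *)
Lemma binomial_coefSl g n :
  n.+1%:R * binomial_coef g n.+1 = - g * (pochhammer (1 - g) n / n`!%:R).
Proof.
rewrite /binomial_coef pochhammerSl factSr (addrC (- g)).
have : n.+1%:R != 0 :> R by rewrite pnatr_eq0.
by move: (factr_neq0 n) => *; field; apply/andP.
Qed.

(** Partial sums are the coefficients of $(1-y)^g/(1-y) = (1-y)^{g-1}$, hence the shift from $-g$ to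
    $1-g$. *)
Lemma sum_binomial_coef g n :
  \sum_(0 <= i < n.+1) binomial_coef g i = pochhammer (1 - g) n / n`!%:R.
Proof.
elim: n => [|n IH].
  by rewrite big_nat1 binomial_coef0 /pochhammer big_ord0 fact0 divr1.
rewrite big_nat_recr//= IH.
have n1 : n.+1%:R != 0 :> R by rewrite pnatr_eq0.
apply: (mulfI n1); rewrite mulrDr binomial_coefSl pochhammerS factSr.
have -> : n%:R = n.+1%:R - 1 :> R by rewrite -natr1 addrK.
by move: (factr_neq0 n) => *; field; apply/andP.
Qed.

(* Past [n = g] the coefficients have constant sign, so that the sum of their
   absolute values telescopes against the partial sums. *)
Lemma binomial_coef_summable g : 0 <= g ->
  exists M, forall n, \sum_(0 <= i < n) `|binomial_coef g i| <= M.
Proof.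
move=> g0; pose S n := \sum_(0 <= i < n.+1) binomial_coef g i.
pose A n := \sum_(0 <= i < n) `|binomial_coef g i|.
pose n0 := (Num.trunc g).+1.
have gn0 : g <= n0%:R by rewrite ltW// truncnS_gt.
have A_le n m : A n <= A (n + m)%N.
  elim: m => [|m IH]; first by rewrite addn0.
  by rewrite addnS (le_trans IH)// /A big_nat_recr//= lerDl.
exists (A n0.+1 + `|S n0|) => n.
have {A_le}/le_trans := A_le n n0.+1; rewrite addnC; apply.
(* This quantity is conserved: with $q = g/(m+1) \in [0,1]$, the next coefficient is $-q S_m$ and
   $S_{m+1} = (1-q) S_m$, so their absolute values add up to $|S_m|$. *)
suff <- : A (n0.+1 + n)%N + `|S (n0 + n)%N| = A n0.+1 + `|S n0|.
  by rewrite lerDl.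
elim: n => [|n <-]; first by rewrite !addn0.
rewrite !addnS addSn /A big_nat_recr//= -/(A _) -!addrA; congr (_ + _).
set m := (n0 + n)%N.
have m0 : 0 < m.+1%:R :> R by rewrite ltr0n.
have cE : binomial_coef g m.+1 = - (g / m.+1%:R) * S m.
  apply: (mulfI (lt0r_neq0 m0)).
  by rewrite binomial_coefSl -sum_binomial_coef -/(S m); field; rewrite gt_eqF.
have -> : S m.+1 = (1 - g / m.+1%:R) * S m.
  by rewrite /S big_nat_recr//= -/(S m) cE; ring.
have q0 : 0 <= g / m.+1%:R by rewrite divr_ge0// ltW.
have q1 : g / m.+1%:R <= 1.
  rewrite ler_pdivrMr// mul1r (le_trans gn0)// ler_nat /m.
  by rewrite -addnS leq_addr.
have q2 : 0 <= 1 - g / m.+1%:R by rewrite subr_ge0.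
by rewrite cE !normrM normrN (ger0_norm q0) (ger0_norm q2); ring.
Qed.

(** The derivative is $((1-x) S_N' + g S_N)(1-x)^{-g-1}$, and by [binomial_coefS] its first factor
    telescopes to $-N c_N x^{N-1}$. *)
Lemma is_derive_binomial_quotient g N (x : R) : x < 1 ->
  is_derive x (1 : R)
    (fun x : R => (\sum_(0 <= n < N) binomial_coef g n * x ^+ n) * (1 - x) `^ (- g))
    (- (N%:R * binomial_coef g N * x ^+ N.-1 * (1 - x) `^ (- g - 1))).
Proof.
move=> x1; elim: N => [|N IH].
  under eq_fun do rewrite big_geq// mul0r.
  by rewrite !mul0r oppr0; exact: is_derive_cst.
under eq_fun do rewrite big_nat_recr//= mulrDl.
have d1 := is_derive_onem_powR (- g) x1.
have dX : is_derive x (1 : R) (fun t => binomial_coef g N * t ^+ N)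
    (binomial_coef g N * (N%:R * x ^+ N.-1)).
  apply: is_deriveZ; apply: DeriveDef; first exact: exprn_derivable.
  by rewrite exp_derive /GRing.scale/= mulr1.
apply: (is_derive_eq (is_deriveD IH (is_deriveM dX d1))).
rewrite /GRing.scale/= binomial_coefS.
have x0 : 1 - x != 0 by rewrite gt_eqF// subr_gt0.
have -> : (1 - x) `^ (- g) = (1 - x) * (1 - x) `^ (- g - 1).
  by rewrite powRB ?x0 ?implybT// powRr1 ?subr_ge0 ?(ltW x1)// mulrC divfK.
(* The truncated [N.-1] at [N = 0] is harmless, being multiplied by [N%:R]. *)
case: N {IH dX} => [|N] /=; first by rewrite !expr0; ring.
rewrite exprS; ring.
Qed.

Lemma binomial_series_cvg g y : 0 <= g -> 0 <= y -> y < 1 ->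
  series (fun n => binomial_coef g n * y ^+ n) @ \oo --> (1 - y) `^ g.
Proof.
move=> g0 y0 y1; have [M HM] := binomial_coef_summable g0.
have y1' : 0 < 1 - y by rewrite subr_gt0.
pose G N (x : R) :=
  (\sum_(0 <= n < N) binomial_coef g n * x ^+ n) * (1 - x) `^ (- g).
(* Constant of the mean value estimate on $[0,y]$: $(N+1)|c_{N+1}| = g|S| \le gM$ with $S$ the sum
   of $c_0, \ldots, c_N$, the interval has length $y$, and $(1-x)^{-g-1}$ increases with $x$. *)
pose K := g * M * y * (1 - y) `^ (- g - 1).
have G1 N : `|1 - G N.+1 y| <= K * y ^+ N.
  have G0 : G N.+1 0 = 1.
    rewrite /G big_nat_recl//= binomial_coef0 expr0 mulr1 subr0 powR1 mulr1.
    by rewrite big1_seq ?addr0// => i _; rewrite exprS mul0r mulr0.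
  have dG (x : R) : x <= y -> is_derive x (1 : R) (G N.+1) _ :=
    fun xy => is_derive_binomial_quotient g N.+1 (le_lt_trans xy y1).
  have [|x x0y Gxy] := @MVT_segment R (G N.+1) _ 0 y y0
      (fun x x0y => dG x (ltW (proj2 (andP x0y)))).
    apply: derivable_within_continuous => x; rewrite in_itv/= => /andP[_ /dG[]].
    by [].
  move: x0y; rewrite in_itv/= => /andP[x0 xy].
  have x1 : 0 < 1 - x by rewrite subr_gt0 (le_lt_trans xy).
  rewrite distrC -G0 Gxy subr0 normrM normrN binomial_coefSl -sum_binomial_coef.
  rewrite !normrM normrN (ger0_norm g0) (ger0_norm y0) (ger0_norm (powR_ge0 _ _)).
  rewrite (ger0_norm (exprn_ge0 _ x0)) /K.
  set s := `|_|.
  have sM : s <= M by rewrite (le_trans (ler_norm_sum _ _ _))// HM.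
  have pq : x ^+ N <= y ^+ N by rewrite lerXn2r ?nnegrE.
  have rr : (1 - x) `^ (- g - 1) <= (1 - y) `^ (- g - 1).
    rewrite -opprD !powRN lef_pV2 ?posrE ?powR_gt0//.
    rewrite ge0_ler_powR ?nnegrE ?(ltW x1) ?(ltW y1') ?addr_ge0//.
    by rewrite lerD2l lerN2.
  have -> : forall p r, g * s * p * r * y = g * y * (s * p * r) by move=> *; ring.
  have -> : forall q r, g * M * y * r * q = g * y * (M * q * r) by move=> *; ring.
  rewrite ler_wpM2l ?mulr_ge0// !ler_pM// ?mulr_ge0 ?normr_ge0 ?exprn_ge0//.
  exact: powR_ge0.
have cG : (fun N => G N.+1 y) @ \oo --> (1 : R).
  have K0 : (fun N => K * y ^+ N) @ \oo --> (0 : R).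
    rewrite -[X in _ --> X](mulr0 K); apply: cvgMr; apply: cvg_expr.
    by rewrite ger0_norm.
  apply: (@squeeze_cvgr _ _ _ _ (fun N => 1 - K * y ^+ N) (fun N => 1 + K * y ^+ N)).
  - near=> N; have := G1 N; rewrite ler_norml => /andP[? ?].
    by apply/andP; split; lra.
  - by rewrite -[X in _ --> X]subr0; apply: cvgB => //; exact: cvg_cst.
  - by rewrite -[X in _ --> X]addr0; apply: cvgD => //; exact: cvg_cst.
(* Multiplying $G_{N+1}(y) \to 1$ by $(1-y)^g$ recovers the partial sums. *)
rewrite -(cvg_shiftS (series _)) -[(1 - y) `^ g]mul1r.
rewrite (_ : [sequence _]_n = fun n => G n.+1 y * (1 - y) `^ g).
  by apply: cvgMl.
apply/funext => n; rewrite /G -mulrA -powRD ?addNr ?powRr0 ?mulr1//.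
by rewrite eqxx (gt_eqF y1').
Unshelve. all: by end_near. Qed.

End binomial_coef.

(** * Euler's integral for the Gauss series *)

Section Euler_integral.
Context {R : realType}.
Implicit Types (a b g z t : R) (n : nat).
Notation mu := (@lebesgue_measure R).

Lemma beta_kernel_addn a b t n : 0 < a -> 0 <= t <= 1 ->
  beta_kernel (a + n%:R) b t = beta_kernel a b t * t ^+ n.
Proof.
move=> a0 t01; elim: n => [|n IH]; first by rewrite addr0 expr0 mulr1.
rewrite -natr1 addrA beta_kernel_succl ?ltr_wpDr// IH exprS; ring.
Qed.

(** Starts from [a * Beta a 1 = 1]; [Beta_succ_sym] carries positivity from one second argument to
    the next. *)
Lemma Beta_natr_gt0 a n : 0 < a -> 0 < Beta a n.+1%:R.
Proof.
elim: n a => [|n IH] a a0.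
  have := integral_beta_kernelx1 a0 => h.
  have : a * Beta a 1 = 1.
    rewrite BetaE -RintegralZl//; last exact: integrable_beta_kernel.
    by rewrite /Rintegral h.
  by move=> aB; rewrite -(pmulr_rgt0 _ a0) aB.
rewrite -natr1 -(pmulr_rgt0 _ a0) Beta_succ_sym//.
by rewrite mulr_gt0// IH// addr_gt0.
Qed.

(** The kernel decreases in [b], so a larger integer second argument gives a positive lower
    bound. *)
Lemma Beta_gt0 a b : 0 < a -> 0 < b -> 0 < Beta a b.
Proof.
move=> a0 b0; pose n := (Num.trunc b).+1.
have bn : b <= n.+1%:R.
  by rewrite (le_trans (ltW (truncnS_gt b)))// ler_nat.
apply: (lt_le_trans (Beta_natr_gt0 n a0)).
apply: le_Rintegral; rewrite -?/(beta_kernel _ _ _) => //.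
- exact: integrable_beta_kernel.
- exact: integrable_beta_kernel.
- move=> t /=; rewrite in_itv/= => /andP[t0 t1].
  (* At [t = 1] the base is 0; the larger exponent is the nonzero [n], so its power is 0. *)
  rewrite ler_wpM2l ?powR_ge0//; have [->|t1'] := eqVneq t 1.
    by rewrite subrr powR0 ?powR_ge0// -natr1 addrK pnatr_eq0.
  apply: ger_powR; last by rewrite lerD2r.
  by rewrite subr_gt0 lt_neqAle t1' t1/= gerBl.
Qed.

Lemma integrable_beta_kernel_poly a b (u : nat -> R) n : 0 < a -> 0 < b ->
  mu.-integrable `[0, 1]
    (EFin \o (fun t => beta_kernel a b t * \sum_(0 <= i < n) u i * t ^+ i)).
Proof.
move=> a0 b0; elim: n => [|n IH].
  under [fun t => _]eq_fun do rewrite big_geq// mulr0.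
  exact: integrable0.
have ian : mu.-integrable `[0, 1]
    (fun t => (u n)%:E * (beta_kernel (a + n%:R) b t)%:E)%E.
  apply: integrableZl => //; apply: integrable_beta_kernel => //.
  by rewrite ltr_wpDr.
apply: eq_integrable (integrableD _ IH ian) => //.
  move=> t; rewrite inE/= in_itv/= => t01.
  by rewrite big_nat_recr//= beta_kernel_addn// -EFinM -EFinD; congr EFin; ring.
Qed.

Lemma Rintegral_beta_kernel_poly a b (u : nat -> R) n : 0 < a -> 0 < b ->
  \int[mu]_(t in `[0, 1]) (beta_kernel a b t * \sum_(0 <= i < n) u i * t ^+ i) =
  \sum_(0 <= i < n) u i * Beta (a + i%:R) b.
Proof.
move=> a0 b0; elim: n => [|n IH].
  rewrite big_geq//; under eq_Rintegral do rewrite big_geq// mulr0.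
  by rewrite Rintegral_cst// mul0r.
rewrite big_nat_recr//= -IH BetaE.
have ian : mu.-integrable `[0, 1] (EFin \o beta_kernel (a + n%:R) b).
  by apply: integrable_beta_kernel => //; rewrite ltr_wpDr.
rewrite -RintegralZl// -RintegralD//; last 2 first.
- exact: integrable_beta_kernel_poly.
- exact: (integrableZl _ (u n) ian).
apply: eq_Rintegral => t; rewrite inE/= in_itv/= => t01.
by rewrite big_nat_recr//= beta_kernel_addn//; ring.
Qed.

Lemma measurable_lpushbeta_kernel a b g z :
  measurable_fun [set: R] (lpushbeta_kernel a b g z).
Proof.
apply: measurable_funM; first exact: measurable_beta_kernel.
apply: (measurableT_comp (@measurable_powR R g)).
by apply: measurable_funB => //; exact: measurable_funM.
Qed.

Lemma lpushbeta_kernel_ge0 a b g z t : 0 <= lpushbeta_kernel a b g z t.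
Proof. by rewrite !mulr_ge0 ?powR_ge0. Qed.

Lemma Rintegral_lpushbeta_kernel a b g z :
  0 < a -> 0 < b -> 0 <= g -> 0 <= z -> z <= 1 ->
  mu.-integrable `[0, 1] (EFin \o lpushbeta_kernel a b g z) /\
  \int[mu]_(t in `[0, 1]) lpushbeta_kernel a b g z t =
  Beta a b * hyp2F1 (- g) a (a + b) z.
Proof.
move=> a0 b0 g0 z0 z1; have [M HM] := binomial_coef_summable g0.
pose u n := binomial_coef g n * z ^+ n.
pose f n t := beta_kernel a b t * \sum_(0 <= i < n) u i * t ^+ i.
(* Dropping the null point [t = 1] ensures [t * z < 1] even for [z = 1]. *)
have sub01 : `[0, 1[%classic `<=` `[0 : R, 1]%classic.
  by move=> t /=; rewrite !in_itv/= => /andP[-> /ltW].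
have ibeta : mu.-integrable `[0, 1[ (fun t => M%:E * (beta_kernel a b t)%:E)%E.
  apply: integrableZl => //; apply: integrableS (integrable_beta_kernel a0 b0) => //.
have mf n : measurable_fun [set: R] (f n).
  apply: measurable_funM; first exact: measurable_beta_kernel.
  by apply: measurable_sum => i; exact: measurable_funM.
have pt t : t \in `[0, 1[ -> f n t @[n --> \oo] --> lpushbeta_kernel a b g z t.
  rewrite in_itv/= => /andP[t0 t1]; apply: cvgMr.
  have tz : t * z < 1 by rewrite (le_lt_trans _ t1)// -[leRHS]mulr1 ler_wpM2l.
  have := binomial_series_cvg g0 (mulr_ge0 t0 z0) tz.
  rewrite /series/=; under eq_fun do under eq_bigr do rewrite exprMn mulrCA mulrC.
  by [].
(* Since [t] and [z] lie in $[0,1]$, each partial sum is at most the sum of the absolute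
   coefficients, hence at most [M]. *)
have bd n t : t \in `[0, 1[ -> `|f n t| <= M * beta_kernel a b t.
  rewrite in_itv/= => /andP[t0 t1].
  rewrite normrM (ger0_norm (beta_kernel_ge0 _ _ _)) mulrC.
  rewrite ler_wpM2r ?beta_kernel_ge0// (le_trans _ (HM n))//.
  rewrite (le_trans (ler_norm_sum _ _ _))// ler_sum// => i _.
  rewrite /u -mulrA normrM -[leRHS]mulr1 ler_wpM2l// ger0_norm.
    by apply: mulr_ile1; rewrite ?exprn_ge0 ?exprn_ile1 ?(ltW t1).
  by rewrite mulr_ge0 ?exprn_ge0.
have [ik _ cvgI] : [/\ mu.-integrable `[0, 1[ (EFin \o lpushbeta_kernel a b g z),
    (\int[mu]_(t in `[0%R, 1%R[) `|(f n t)%:E - (lpushbeta_kernel a b g z t)%:E|)%E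
       @[n --> \oo] --> 0%E &
    (\int[mu]_(t in `[0%R, 1%R[) (f n t)%:E)%E @[n --> \oo] -->
    (\int[mu]_(t in `[0%R, 1%R[) (lpushbeta_kernel a b g z t)%:E)%E].
  apply: dominated_convergence ibeta _ => //.
  - by move=> n; apply/measurable_EFinP; apply: measurable_funTS; exact: mf.
  - apply/measurable_EFinP; apply: measurable_funTS.
    exact: measurable_lpushbeta_kernel.
  - by apply: aeW => t t01; apply: cvg_EFin; [exact: nearW|exact: pt].
  - by apply: aeW => t n t01; rewrite lee_fin; exact: bd.
have ik1 : mu.-integrable `[0, 1] (EFin \o lpushbeta_kernel a b g z).
  apply/integrableP; split.
    apply/measurable_EFinP; apply: measurable_funTS.
    exact: measurable_lpushbeta_kernel.
  rewrite -integral_itv_bndo_bndc; first by have /integrableP[] := ik.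
  apply: measurableT_comp => //; apply/measurable_EFinP; apply: measurable_funTS.
  exact: measurable_lpushbeta_kernel.
split => //.
have If n : \int[mu]_(t in `[0, 1[) f n t = Beta a b *
    series (fun n => pochhammer (- g) n * pochhammer a n /
      pochhammer (a + b) n * (z ^+ n / n`!%:R)) n.
  rewrite Rintegral_itv_bndo_bndc; last first.
    by apply: integrableS (integrable_beta_kernel_poly u n a0 b0).
  rewrite Rintegral_beta_kernel_poly// /series/= mulr_sumr.
  by apply: eq_bigr => i _; rewrite Beta_addn// /u /binomial_coef; ring.
have B0 := Beta_gt0 a0 b0.
rewrite -Rintegral_itv_bndo_bndc//.
set I := \int[mu]_(t in _) _.
(* After division by the positive [Beta a b], the integrals of [f n] are the partial sums of the
   Gauss series, so the [limn] in [hyp2F1] is a genuine limit. *)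
apply: (mulfI (invr_neq0 (lt0r_neq0 B0))); rewrite mulKf ?gt_eqF//.
apply/esym/cvg_lim => //.
rewrite (_ : series _ = fun n => (Beta a b)^-1 * \int[mu]_(t in `[0, 1[) f n t).
  apply: cvgMr.
  have Ifin : (\int[mu]_(t in `[0%R, 1%R[)
      (lpushbeta_kernel a b g z t)%:E)%E \is a fin_num.
    exact: (integrable_fin_num _ ik).
  by move: cvgI; rewrite -(fineK Ifin) => /fine_cvg.
by apply/funext => n; rewrite If mulKf// gt_eqF.
Qed.

End Euler_integral.

(** * Expectations computed from a density *)

(** [f] has the same integrals over measurable sets as the Radon-Nikodym derivative, so the two
    agree almost everywhere and its change of variables formula carries over. *)
Lemma ge0_integral_density (d : measure_display) (T : measurableType d)
    (R : realType) (nu : {finite_measure set T -> \bar R})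
    (mu : {sigma_finite_measure set T -> \bar R}) (f : T -> R) (h : T -> \bar R) :
  measurable_fun [set: T] f -> (forall x, 0 <= f x) ->
  (forall A, measurable A -> nu A = (\int[mu]_(x in A) (f x)%:E)%E) ->
  measurable_fun [set: T] h -> (forall x, (0 <= h x)%E) ->
  (\int[nu]_x h x = \int[mu]_x (h x * (f x)%:E))%E.
Proof.
move=> mf f0 nuE mh h0.
have mf' : measurable_fun [set: T] (EFin \o f) by exact/measurable_EFinP.
have numu : nu `<< mu.
  apply/null_content_dominatesP => A mA muA0; rewrite nuE//.
  by apply: null_set_integral => //; exact: measurable_funTS.
have intf : mu.-integrable [set: T] (EFin \o f).
  apply/integrableP; split => //.
  under eq_integral do rewrite gee0_abs ?lee_fin//.
  by rewrite -nuE// -ge0_fin_numE// fin_num_measure.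
rewrite -(Radon_Nikodym_SigmaFinite.change_of_variables numu)//.
have iRN := Radon_Nikodym_SigmaFinite.f_integrable numu.
apply: ae_eq_integral => //.
- by apply: emeasurable_funM => //; exact: measurable_int iRN.
- exact: emeasurable_funM.
- apply: ae_eqe_mul2l; apply: integral_ae_eq => // A _ mA.
  by rewrite -Radon_Nikodym_SigmaFinite.f_integral// nuE.
Qed.

(** Cutting [h] off outside [D] makes it nonnegative everywhere and changes [h \o X] only on a null
    event. This admits odd powers, which are negative left of 0. *)
Lemma expectation_density (d d' : measure_display) (T : measurableType d)
    (T' : measurableType d') (R : realType) (P : probability T R)
    (mu : {sigma_finite_measure set T' -> \bar R}) (X : {RV P >-> T'})
    (f h : T' -> R) (D : set T') :
  measurable_fun [set: T'] f -> (forall x, 0 <= f x) ->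
  (forall A, measurable A ->
    distribution P X A = (\int[mu]_(x in A) (f x)%:E)%E) ->
  measurable D -> (forall x, ~ D x -> f x = 0) ->
  measurable_fun [set: T'] h -> (forall x, D x -> 0 <= h x) ->
  ('E_P[h \o X] = \int[mu]_(x in D) (h x * f x)%:E)%E.
Proof.
move=> mf f0 PX mD fD mh h0; rewrite unlock.
pose h' := h \_ D.
have mh' : measurable_fun [set: T'] h'.
  by apply/(measurable_restrictT h mD); exact: measurable_funTS.
have h'0 x : 0 <= h' x.
  by rewrite /h' patchE; case: ifPn => // /set_mem; exact: h0.
have mEh' : measurable_fun [set: T'] (EFin \o h') by exact/measurable_EFinP.
have Eh'0 x : (0 <= (EFin \o h') x)%E by rewrite lee_fin.
transitivity (\int[P]_w ((EFin \o h') \o X) w)%E.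
  apply: ae_eq_integral => //.
  - exact/measurable_EFinP/measurableT_comp.
  - by apply: measurableT_comp => //; exact/measurable_EFinP.
  (* The exceptional event is that [X] leaves [D]; its probability is the integral of a density
     vanishing there. *)
  - exists (X @^-1` (~` D)); split.
    + rewrite -[X in measurable X]setTI.
      by apply: (measurable_funPT X) => //; exact: measurableC.
    + rewrite -[LHS]/(distribution P X (~` D)) PX; last exact: measurableC.
      by apply: integral0_eq => x /fD ->.
    + move=> w /= hw Dw; apply: hw => _ /=.
      by rewrite /h' patchE mem_set.
rewrite -(ge0_integral_distribution X mEh' Eh'0).
rewrite (ge0_integral_density mf f0 PX mEh' Eh'0).
rewrite [RHS]integral_mkcond; apply: eq_integral => x _.
rewrite /= -EFinM /h' !patchE; case: ifPn => // _.
by rewrite mul0r.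
Qed.

(** * Moments of the left-pushed beta distribution *)

Lemma measurable_lpushbeta_pdf (R : realType) (a b g z : R) :
  measurable_fun [set: R] (lpushbeta_pdf a b g z).
Proof.
apply/(measurable_restrictT _ (measurable_itv _)); apply: measurable_funTS.
apply: measurable_funM; last exact: measurable_cst.
exact: measurable_lpushbeta_kernel.
Qed.

Theorem mainTheorem11 (R : realType) (alpha beta gamma phi : R)
    (halpha : 0 < alpha) (hbeta : 0 < beta) (hgamma : 0 <= gamma)
    (hphi0 : 0 <= phi) (hphi1 : phi <= 1)
    (d : measure_display) (T : measurableType d) (P : probability T R)
    (X : {RV P >-> R})
    (hX : LPushBeta_distributed X alpha beta gamma phi)
    (k : nat) (hk : (0 < k)%N) :
  ('E_P[(fun w => X w ^+ k)%R] =
    (Beta (alpha + k%:R) beta / Beta alpha beta *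
     (hyp2F1 (- gamma) (alpha + k%:R) (alpha + beta + k%:R) phi /
      hyp2F1 (- gamma) alpha (alpha + beta) phi))%R%:E)%E /\
  ('E_P[(fun w => X w ^+ k)%R] =
    ((\int[lebesgue_measure]_(x in `[0, 1])
        (x `^ (alpha + k%:R - 1) * (1 - x) `^ (beta - 1) *
         (1 - x * phi) `^ gamma)) /
     (\int[lebesgue_measure]_(x in `[0, 1])
        (x `^ (alpha - 1) * (1 - x) `^ (beta - 1) *
         (1 - x * phi) `^ gamma)))%R%:E)%E.
Proof.
pose mu := @lebesgue_measure R.
have ak0 : 0 < alpha + k%:R by rewrite ltr_wpDr.
have [_ ZE] := Rintegral_lpushbeta_kernel halpha hbeta hgamma hphi0 hphi1.
have [ikk ZkE] := Rintegral_lpushbeta_kernel ak0 hbeta hgamma hphi0 hphi1.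
set Z := \int[_]_(t in _) _ in ZE.
set Zk := \int[_]_(t in _) _ in ZkE.
have Z0 : 0 <= Z by apply: Rintegral_ge0 => t _; exact: lpushbeta_kernel_ge0.
(* [lebesgue_measure] lives on [measurableTypeR R], whose measurable sets are
   those of [R] but whose display differs. *)
have mX : @measurable_fun _ _ T (measurableTypeR R) setT X.
  by move=> mT B mB; exact: (@measurable_funPT _ _ _ _ X mT B mB).
pose Y : {RV P >-> measurableTypeR R} :=
  HB.pack (X : T -> measurableTypeR R)
    (isMeasurableFun.Build _ _ T (measurableTypeR R) X mX).
(* Both claims follow from this one value: the second is [Zk / Z] unfolded, the first applies
   Euler's identity to [Zk] and [Z]. *)
have -> : ('E_P[(fun w => X w ^+ k)%R] = (Zk / Z)%:E)%E.
  rewrite (@expectation_density _ _ _ _ R P lebesgue_measure Y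
    (lpushbeta_pdf alpha beta gamma phi)
    (fun x => x ^+ k) `[0, 1]%classic) => //; last 4 first.
  - exact: measurable_lpushbeta_pdf.
  - move=> x; rewrite /lpushbeta_pdf patchE; case: ifPn => // _.
    by rewrite divr_ge0// lpushbeta_kernel_ge0.
  - by move=> x xD; rewrite /lpushbeta_pdf patchE memNset.
  - by move=> x /=; rewrite in_itv/= => /andP[x0 _]; exact: exprn_ge0.
  transitivity (\int[mu]_(x in `[0%R, 1%R])
      ((lpushbeta_kernel (alpha + k%:R) beta gamma phi x / Z)%:E))%E.
    apply: eq_integral => x xD; rewrite /lpushbeta_pdf patchE xD.
    move: xD; rewrite inE/= in_itv/= => x01; congr EFin.
    rewrite mulrA -/Z; congr (_ / _).
    (* The factor [x ^+ k] is absorbed by moving [alpha] to [alpha + k%:R]. *)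
    have := beta_kernel_addn beta k halpha x01.
    by rewrite /beta_kernel /lpushbeta_kernel => ->; ring.
  under eq_integral do rewrite EFinM.
  rewrite integralZr// EFinM; congr (_ * _)%E.
  by rewrite /Zk /Rintegral fineK//; exact: integrable_fin_num.
split; last by [].
by rewrite ZE ZkE (addrAC alpha) invfM mulrACA.
Qed.
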